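(* For every $\beta>1$ there exists $1<\beta'<2$ such that the beta-shifts $\mathsf{X}_\beta$ and $\mathsf{X}_{\beta'}$ are flow equivalent.
   Context: For $\beta>1$, let $e(\beta)=x_1x_2\cdots$ be the $\beta$-expansion of $1$ ($x_1=\lfloor\beta\rfloor$, $r_1=\{\beta\}$, $x_n=\lfloor\beta r_{n-1}\rfloor$, $r_n=\{\beta r_{n-1}\}$). The beta-shift $\mathsf{X}_\beta$ is the two-sided shift space (with the left shift) whose language is the set of all words $x_n(t)\cdots x_m(t)$, $1\le n\le m$, occurring in $\beta$-expansions of numbers $t\in[0,1]$ (defined analogously with $r_1(t)=\{\beta t\}$, $x_1(t)=\lfloor\beta t\rfloor$). For a shift space $(X,\sigma)$, the suspension flow is $SX=X\times\mathbb{R}/\sim$ with $(x,t)\sim(\sigma(x),t-1)$, and $[x,t]+r=[x,t+r]$. Shift spaces $X,Y$ are flow equivalent if there is a homeomorphism $\Phi\colon SX\to SY$ such that for each $z\in SX$ there is a monotonically increasing $\varphi_z\colon\mathbb{R}\to\mathbb{R}$ with $\Phi(z+r)=\Phi(z)+\varphi_z(r)$ for all $r$. *)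

(* Defs.v *)
From HB Require Import structures.
From mathcomp Require Import all_boot all_order all_algebra.
From mathcomp Require Import generic_quotient.
From mathcomp Require Import all_classical all_reals all_analysis.

Set Implicit Arguments.
Unset Strict Implicit.
Unset Printing Implicit Defensive.

Import Order.TTheory GRing.Theory Num.Theory.
Import numFieldTopology.Exports.
Local Open Scope classical_set_scope.
Local Open Scope ring_scope.
Local Open Scope quotient_scope.

Definition fracp {R : realType} (x : R) : R := x - (Num.floor x)%:~R.

Fixpoint beta_rem {R : realType} (beta t : R) (n : nat) : R :=
  match n with
  | 0 => t
  | n'.+1 => fracp (beta * beta_rem beta t n')
  end.

(* digits: x_n(t) = floor(beta r_{n-1}(t)), meaningful for n >= 1
   (x_1(t) = floor(beta t)); beta r_{n-1} >= 0, so the floor is a nat. *)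
Definition beta_digit {R : realType} (beta t : R) (n : nat) : nat :=
  `|Num.floor (beta * beta_rem beta t n.-1)|%N.

Definition beta_exp_one {R : realType} (beta : R) (n : nat) : nat :=
  beta_digit beta 1 n.

Definition beta_language {R : realType} (beta : R) : set (seq nat) :=
  [set w | exists (t : R) (n m : nat),
      [/\ 0 <= t <= 1, (1 <= n <= m)%N &
          w = [seq beta_digit beta t k | k <- iota n (m - n).+1]]].

Definition fullshift := {ptws int -> nat}.

Definition beta_shift {R : realType} (beta : R) : set fullshift :=
  [set x | forall (i : int) (l : nat),
      beta_language beta [seq x (i + k%:Z) | k <- iota 0 l.+1]].

Section Suspension.
Context {R : realType} {A : topologicalType} (X : set {ptws int -> A}).

(* (x,t) ~ (sigma^n x, t - n) for some integer n, where (sigma x)_i = x_{i+1};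
   this is the equivalence relation generated by (x,t) ~ (sigma x, t - 1). *)
Definition susp_rel (p q : set_type X * R) : Prop :=
  exists n : int, (forall i : int, set_val q.1 i = set_val p.1 (i + n))
                  /\ q.2 = p.2 - n%:~R.

Definition susp_relb (p q : set_type X * R) : bool := `[< susp_rel p q >].

Lemma susp_relb_refl : reflexive susp_relb.
Proof.
move=> p; apply/asboolP; exists 0; split; first by move=> i; rewrite addr0.
by rewrite subr0.
Qed.

Lemma susp_relb_sym : symmetric susp_relb.
Proof.
suff H : forall p q, susp_relb p q -> susp_relb q p.
  by move=> p q; apply/idP/idP; apply: H.
move=> p q /asboolP [n [H1 H2]]; apply/asboolP; exists (- n); split.
  by move=> i; rewrite H1 -addrA addNr addr0.
by rewrite H2 mulrNz opprK subrK.
Qed.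

Lemma susp_relb_trans : transitive susp_relb.
Proof.
move=> q p r /asboolP [n [H1 H2]] /asboolP [m [H3 H4]]; apply/asboolP.
exists (m + n); split.
  by move=> i; rewrite H3 H1 addrA.
by rewrite H4 H2 mulrzDr opprD addrA addrAC.
Qed.

Definition susp_equiv : equiv_rel (set_type X * R) :=
  EquivRel susp_relb susp_relb_refl susp_relb_sym susp_relb_trans.

End Suspension.

Notation suspension R X :=
  (quotient_topology {eq_quot (@susp_equiv R _ X)}).

Definition susp_flow {R : realType} {A : topologicalType}
    {X : set {ptws int -> A}} (z : suspension R X) (r : R) : suspension R X :=
  \pi_(suspension R X) ((repr z).1, (repr z).2 + r).

Definition homeomorphism {S T : topologicalType} (f : S -> T) : Prop :=
  continuous f /\
  exists g : T -> S, [/\ cancel f g, cancel g f & continuous g].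

Definition flow_equivalent (R : realType) {A B : topologicalType}
    (X : set {ptws int -> A}) (Y : set {ptws int -> B}) : Prop :=
  exists Phi : suspension R X -> suspension R Y,
    homeomorphism Phi /\
    forall z : suspension R X, exists phi : R -> R,
      {homo phi : a b / a < b} /\
      forall r : R, Phi (susp_flow z r) = susp_flow (Phi z) (phi r).

(* Main.v *)
(* Let d be the quasi-greedy expansion of 1 in base beta. The beta-shift is the
   set of bi-infinite sequences all of whose right tails are lexicographically
   at most d. The coding a |-> 1^a 0 is order preserving and uniquely decodable,
   so it carries this shift, up to translation, onto the shift attached in the
   same way to the coded sequence d' of d; the latter dominates its own tails,
   hence by Parry's theorem is the quasi-greedy expansion of 1 in some base
   beta', and 1 < beta' < 2 since its digits are 0 and 1 and not all 1. On
   suspensions, replacing a letter a by a word of length a + 1 is the time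
   change that stretches the unit interval over a to length a + 1. *)

Require Import Defs.
From HB Require Import structures.
From mathcomp Require Import all_boot all_order all_algebra.
From mathcomp Require Import all_classical all_reals all_analysis.
From mathcomp Require Import zify ring lra.
Import Order.TTheory GRing.Theory Num.Theory.
Import numFieldNormedType.Exports.
Local Open Scope ring_scope.
Set Implicit Arguments.
Unset Strict Implicit.
Unset Printing Implicit Defensive.
Local Open Scope classical_set_scope.

(** * Quasi-greedy expansions and the lexicographic description of beta-shifts *)

(** This is the lexicographic order [s <= d] on infinite sequences; no first difference is named,
    and equality needs no separate case. *)
Definition lelex (s d : nat -> nat) :=
  forall k, (forall j, (j < k)%N -> s j = d j) -> (s k <= d k)%N.

Definition rtail (x : int -> nat) (i : int) : nat -> nat :=
  fun k => x (i + k%:Z).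

Definition lexshift (d : nat -> nat) : set fullshift :=
  [set x | forall i, lelex (rtail x i) d].

(** Lexicographic comparison of a finite word with the tail of [d] from place [i], a prefix of that
    tail being accepted. The offset [i] is matched with the remainder [r i] in [wval_lt]. *)
Fixpoint lexw (u : seq nat) (d : nat -> nat) (i : nat) : Prop :=
  if u is a :: s then (a < d i)%N \/ a = d i /\ lexw s d i.+1 else True.

Fixpoint admissible (u : seq nat) (d : nat -> nat) : Prop :=
  if u is _ :: s then lexw u d 0 /\ admissible s d else True.

Lemma lelex_lexw s d i l :
  lelex s (fun k => d (i + k)%N) -> lexw (mkseq s l) d i.
Proof.
elim: l s i => [|l IH] s i sd //.
have -> : mkseq s l.+1 = s 0%N :: mkseq (s \o S) l.
  by rewrite /mkseq /= (iotaDl 1 0 l) -map_comp.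
have := sd 0%N; rewrite addn0 => /(_ (fun j => ltac:(by []))).
rewrite leq_eqVlt => /orP[/eqP e|lt]; last by left.
right; split => //; apply: IH => k agree.
have := sd k.+1; rewrite addnS addSn; apply => -[_|j jk]; first by rewrite addn0.
by have := agree j jk; rewrite addnS addSn.
Qed.

Lemma lelex_admissible s d l :
  (forall n, lelex (fun k => s (n + k)%N) d) -> admissible (mkseq s l) d.
Proof.
elim: l s => [|l IH] s sd //.
have e : mkseq s l.+1 = s 0%N :: mkseq (s \o S) l.
  by rewrite /mkseq /= (iotaDl 1 0 l) -map_comp.
have := @lelex_lexw s d 0 l.+1 (sd 0%N); rewrite e => w; split => //.
by apply: IH => n; apply: (sd n.+1).
Qed.

Section BetaLex.
Context {R : realType}.
Implicit Types (b : R) (r : nat -> R) (d : nat -> nat).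

Fixpoint wval b (u : seq nat) : R :=
  if u is a :: s then (a%:R + wval b s) / b else 0.

Lemma wval_ge0 b u : 0 < b -> 0 <= wval b u.
Proof.
by move=> b0; elim: u => //= a s IH; rewrite divr_ge0 ?addr_ge0// ltW.
Qed.

(** If the first letter is below [d i], the rest has value less than [r 0 = 1] and cannot make up
    for the missing unit; if it equals [d i], the comparison moves on one place. Only positivity of
    [r] is assumed, so that [parry] can apply this before the bound [r <= 1] is known. *)
Lemma wval_lt b d r u i : 0 < b -> r 0%N = 1 -> (forall n, 0 < r n) ->
  (forall n, r n.+1 = b * r n - (d n)%:R) ->
  lexw u d i -> admissible (behead u) d -> wval b u < r i.
Proof.
move=> b0 r0 rp rS; elim: u i => [|a s IH] i //=.
have sadm : admissible s d -> admissible (behead s) d by case: s {IH} => //= ? ? [].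
rewrite ltr_pdivrMr// mulrC => -[lt|[-> w]] sd; have := rS i.
- have w0 : lexw s d 0 by case: s sd {IH sadm} => //= ? ? [].
  have := IH 0%N w0 (sadm sd); have := rp i.+1; rewrite r0.
  have : (a%:R + 1 <= (d i)%:R :> R) by rewrite natr1 ler_nat.
  lra.
- by have := IH i.+1 w (sadm sd); lra.
Qed.

(* The remainders of the quasi-greedy expansion of 1: unlike for the greedy
   expansion they lie in ]0, 1], so the expansion never terminates. *)
Definition quasi_greedy b d r :=
  [/\ r 0%N = 1, forall n, 0 < r n <= 1 & forall n, r n.+1 = b * r n - (d n)%:R].

Lemma floor_digit (a : nat) (v : R) : 0 <= v < 1 -> Num.floor (a%:R + v) = a%:Z.
Proof. by move=> v01; apply/floor_def; rewrite intrD -pmulrn; lra. Qed.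

(** Multiplication by [b] brings the first letter to the integer part and leaves the value of the
    next suffix, which is below 1: the greedy algorithm reads the word back. *)
Lemma beta_rem_wval b u j : 0 < b ->
  (forall k, wval b (drop k u) < 1) -> (j <= size u)%N ->
  beta_rem b (wval b u) j = wval b (drop j u).
Proof.
move=> b0 vu; elim: j => [|j IH] ju; first by rewrite drop0.
rewrite /= IH ?(ltnW ju)// (drop_nth 0%N ju) /=.
rewrite mulrC divfK ?gt_eqF// /fracp floor_digit ?wval_ge0 ?vu//.
by rewrite -pmulrn addrC addKr.
Qed.

Lemma beta_digit_wval b u j : 0 < b ->
  (forall k, wval b (drop k u) < 1) -> (j < size u)%N ->
  beta_digit b (wval b u) j.+1 = nth 0%N u j.
Proof.
move=> b0 vu ju; rewrite /beta_digit /= beta_rem_wval// ?(ltnW ju)//.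
rewrite (drop_nth 0%N ju) /= mulrC divfK ?gt_eqF//.
by rewrite floor_digit ?wval_ge0 ?vu.
Qed.

Lemma fracp_bound (x : R) : 0 <= fracp x < 1.
Proof. by rewrite /fracp; have := ge_floor x; have := lt_succ_floor x; rewrite intrD; lra. Qed.

Lemma beta_rem_bound b t n : 0 <= beta_rem b t n.+1 < 1.
Proof. exact: fracp_bound. Qed.

(** A tail of [x] that agrees with [d] and then exceeds it would need a remainder at least that of
    [d]; conversely a word whose suffixes are all at most [d] is the expansion of its own value. *)
Lemma beta_shift_lexshift b d r : 0 < b -> quasi_greedy b d r ->
  beta_shift b = lexshift d.
Proof.
move=> b0 [r0 rb rS]; apply/seteqP; split => x /= xb i.
- move=> k agree.
  (* The word is read from [i - 1] on, so that the remainder producing [x i] has index [n >= 1] and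
     is below 1, whereas [beta_rem b t 0 = t] may equal 1. *)
  have [t [n [m [_ /andP[n0 nm]]]]] := xb (i - 1) k.+1 => e.
  have sz : (k.+2 = (m - n).+1)%N.
    by have := congr1 size e; rewrite !size_map !size_iota.
  have dig j : (j <= k)%N -> x (i + j%:Z) = beta_digit b t (n + j.+1).
    move=> jk; have := congr1 (fun s => nth 0%N s j.+1) e.
    rewrite -sz !(nth_map 0%N) ?size_iota// !nth_iota// add0n => <-.
    by congr x; lia.
  have remS j : (j <= k)%N -> beta_rem b t (n + j.+1) =
      b * beta_rem b t (n + j) - (x (i + j%:Z))%:R.
    move=> jk; rewrite dig// addnS /= /fracp /beta_digit /=.
    case: n n0 {nm e sz dig} => // n _; rewrite addSn.
    have := beta_rem_bound b t (n + j); set rr := beta_rem _ _ _ => rr01.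
    have : 0 <= b * rr by apply: mulr_ge0; lra.
    by rewrite -floor_ge0 => f0; rewrite natr_absz ger0_norm.
  have lt j : (j <= k)%N -> beta_rem b t (n + j) < r j.
    elim: j => [_|j IH jk].
      rewrite addn0 r0; case: n n0 {nm e sz dig remS} => // n _.
      by have := beta_rem_bound b t n; lra.
    rewrite remS 1?ltnW// rS ltrBlDr; have := agree j jk; rewrite /rtail => ->.
    by rewrite subrK ltr_pM2l// IH// ltnW.
  have ge0 : 0 <= beta_rem b t (n + k.+1).
    by rewrite addnS; have /andP[] := beta_rem_bound b t (n + k).
  have := remS k (leqnn _) => eq; have /andP[_] := rb k.+1; rewrite rS => r1.
  have : (x (i + k%:Z))%:R < (d k)%:R + 1 :> R.
    have : b * beta_rem b t (n + k) < b * r k by rewrite ltr_pM2l ?lt.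
    lra.
  by rewrite natr1 ltr_nat.
- move=> l; set u := map _ _.
  have tails n : lelex (fun k => rtail x i (n + k)%N) d.
    move=> k; have := xb (i + n%:Z) k; rewrite /rtail PoszD addrA => H agree.
    by apply: H => j jk; rewrite -agree// PoszD addrA.
  have uE : u = mkseq (rtail x i) l.+1 by [].
  have ua : admissible u d by rewrite uE; exact: lelex_admissible.
  have v1 k : wval b (drop k u) < 1.
    have da : admissible (drop k u) d.
      by elim: k u {uE} ua => [|k IH] [|a s] //= [_ /IH].
    rewrite -r0; apply: (@wval_lt b d r) => //.
    + by move=> n; have /andP[] := rb n.
    + by case: (drop k u) da => //= ? ? [].
    + by case: (drop k u) da => //= ? ? [].
  exists (wval b u), 1%N, l.+1; split => //.
    by rewrite wval_ge0//= ltW//; have := v1 0%N; rewrite drop0.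
  apply: (@eq_from_nth _ 0%N); first by rewrite !size_map !size_iota subn1.
  move=> j; rewrite size_map size_iota => jl.
  rewrite (nth_map 0%N) ?size_iota ?subn1// nth_iota// add1n beta_digit_wval//.
  by rewrite size_map size_iota.
Qed.

Lemma quasi_greedy_exists b : 1 < b -> exists d r, quasi_greedy b d r.
Proof.
move=> b1.
(* The digit [ceil(b r) - 1] is the largest integer strictly below [b r], which keeps the next
   remainder in []0, 1]]. *)
pose r := fix r n : R :=
  if n is n'.+1 then b * r n' - (Num.ceil (b * r n') - 1)%:~R else 1.
have rb n : 0 < r n <= 1.
  elim: n => [|n IH] /=; first by rewrite ltr01 lexx.
  by have := ceil_itv (b * r n); rewrite intrB; lra.
exists (fun n => `|Num.ceil (b * r n) - 1|%N), r; split => // n /=.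
rewrite natr_absz ger0_norm// subr_ge0.
have : 0 < Num.ceil (b * r n) by rewrite ceil_gt0 mulr_gt0//; have := rb n; lra.
lia.
Qed.

(** The tail starts from a remainder [r n <= 1 = r 0], and equal digits preserve this inequality;
    hence the first different digit can only be smaller. *)
Lemma quasi_greedy_lelex b d r n : 0 < b -> quasi_greedy b d r ->
  lelex (fun k => d (n + k)%N) d.
Proof.
move=> b0 [r0 rb rS] k agree.
have le j : (j <= k)%N -> r (n + j)%N <= r j.
  elim: j => [_|j IH jk]; first by rewrite addn0 r0; have /andP[] := rb n.
  by rewrite addnS !rS agree// lerD2r ler_pM2l// IH// ltnW.
have := rb (n + k).+1; have := rb k.+1; rewrite !rS => h1 h2.
have : (d (n + k)%N)%:R < (d k)%:R + 1 :> R.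
  have : b * r (n + k)%N <= b * r k by rewrite ler_pM2l ?le.
  lra.
by rewrite natr1 ltr_nat.
Qed.

Lemma quasi_greedy_gt0 b d r : 1 < b -> quasi_greedy b d r -> (0 < d 0)%N.
Proof.
move=> b1 [r0 rb rS]; have := rb 1%N; rewrite rS r0; case: (d 0%N) => // /=; lra.
Qed.

(* Otherwise the remainders grow geometrically. *)
Lemma quasi_greedy_unbounded b d r n : 1 < b -> quasi_greedy b d r ->
  exists2 m, (n <= m)%N & (0 < d m)%N.
Proof.
move=> b1 [r0 rb rS]; apply: contrapT => H.
have d0 m : (n <= m)%N -> d m = 0%N.
  by move=> nm; apply/eqP; rewrite -leqn0 leqNgt; apply/negP => dm; apply: H; exists m.
have rg k : r n * (1 + k%:R * (b - 1)) <= r (n + k)%N.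
  elim: k => [|k IH]; first by rewrite addn0 mul0r addr0 mulr1.
  rewrite addnS rS d0 ?leq_addr// subr0.
  have : 0 <= (b - 1) * (b - 1) * (k%:R * r n).
    by rewrite !mulr_ge0 ?subr_ge0 ?ler0n// ltW//; have /andP[] := rb n.
  have : b * (r n * (1 + k%:R * (b - 1))) <= b * r (n + k)%N by rewrite ler_pM2l//; lra.
  rewrite -natr1; nra.
have rn0 : 0 < r n by have /andP[] := rb n.
have a0 : 0 < r n * (b - 1) by rewrite mulr_gt0// subr_gt0.
have := rg (Num.bound (r n * (b - 1))^-1).
have := @archi_boundP R (r n * (b - 1))^-1; rewrite invr_ge0 => /(_ (ltW a0)).
set k := Num.bound _ => hk.
have /andP[_ h1] := rb (n + k)%N => h2.
have : 1 < k%:R * (r n * (b - 1)) by rewrite -ltr_pdivrMr// div1r.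
nra.
Qed.

End BetaLex.

(** * Parry's theorem for 0-1 sequences *)

Section Parry.
Context {R : realType}.
Variable e : nat -> nat.
Hypotheses (e_le1 : forall n, (e n <= 1)%N)
  (e_unbounded : forall n, exists2 m, (n <= m)%N & (0 < e m)%N)
  (e0 : e 0 = 1%N) (e_has0 : exists p, e p = 0%N)
  (e_lelex : forall n, lelex (fun k => e (n + k)%N) e).

(** For the fixed digits [e] this is a polynomial in [b]; nothing confines it to []0, 1]] for a
    general [b]. *)
Fixpoint beta_remainder (b : R) (n : nat) : R :=
  if n is n'.+1 then b * beta_remainder b n' - (e n')%:R else 1.

Lemma beta_remainder_continuous n : continuous (fun b : R => beta_remainder b n).
Proof.
elim: n => [|n IH] b /=; first apply: cvg_cst.
by apply: cvgB; [apply: cvgM => //; exact: IH|apply: cvg_cst].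
Qed.

Let eR n : (e n)%:R = 0 :> R \/ (e n)%:R = 1 :> R.
Proof. by case: (e n) (e_le1 n) => [|[]]// _; [left|right]. Qed.

Lemma beta_remainder_lt0S (b : R) n k : 0 < b ->
  beta_remainder b n < 0 -> beta_remainder b (n + k) < 0.
Proof.
move=> b0 rn; elim: k => [|k IH]; first by rewrite addn0.
rewrite addnS /=; have : b * beta_remainder b (n + k) < 0 by rewrite pmulr_rlt0.
by have [->|->] := eR (n + k); lra.
Qed.

(** The threshold [1 / (b - 1)] is the fixed point of [r |-> b * r - 1], the slowest growth that
    digits 0 and 1 allow. *)
Lemma beta_remainder_escape (b : R) n k : 1 < b ->
  1 < (b - 1) * beta_remainder b n -> 1 < (b - 1) * beta_remainder b (n + k).
Proof.
move=> b1 rn; elim: k => [|k IH]; first by rewrite addn0.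
rewrite addnS /=; set r := beta_remainder _ _ in IH *.
have : b < b * ((b - 1) * r) by rewrite ltr_pMr//; lra.
by have [->|->] := eR (n + k); nra.
Qed.

(* The base is the least [b] for which all remainders are nonnegative: were a
   remainder larger than [1 / (b - 1)], the remainders of a slightly smaller
   base would still escape to [+oo]. *)
Lemma parry : exists b r, 1 < b < 2 /\ quasi_greedy b e (r : nat -> R).
Proof.
pose B : set R := [set b | 1 <= b <= 2 /\ forall n, 0 <= beta_remainder b n].
have B2 : B 2.
  split; first by rewrite lexx andbT ler1n.
  move=> n; apply: (@le_trans _ _ 1) => //; elim: n => [|n IH] //=.
  by have [->|->] := eR n; lra.
have Blb : lbound B 1 by move=> b [/andP[]].
have hB : has_inf B by split; [exists 2|exists 1].
pose b := inf B.
have b1 : 1 <= b by apply: lb_le_inf Blb; exists 2.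
have b2 : b <= 2 by apply: ge_inf => //; exists 1.
have near_b (g : R -> R) (P : set R) : continuous g -> open P -> P (g b) ->
    exists2 dl : R, 0 < dl & forall c, `|b - c| < dl -> P (g c).
  move=> cg oP Pb; have := cg b P (open_nbhs_nbhs (conj oP Pb)).
  by move=> /nbhs_ballP[dl dl0 H]; exists dl => // c bc; apply: (H c).
(* Negativity of a polynomial is an open condition, so it would persist at elements of [B] close to
   the infimum. *)
have r_ge0 n : 0 <= beta_remainder b n.
  rewrite leNgt; apply/negP => r0.
  have [dl dl0 H] := near_b _ _ (@beta_remainder_continuous n) (@open_lt _ 0) r0.
  have [c [c12 rc] cb] := inf_adherent dl0 hB.
  have bc : b <= c by apply: ge_inf => //; exists 1.
  have /H /= : `|b - c| < dl by rewrite ler0_norm ?subr_le0// opprB ltrBlDl.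
  by rewrite ltNge rc.
have b_gt0 : 0 < b by lra.
(* A zero remainder would force every later digit to be 0, against [e_unbounded]. *)
have r_gt0 n : 0 < beta_remainder b n.
  rewrite lt_neqAle r_ge0 andbT eq_sym; apply/eqP => rn.
  have rk k : beta_remainder b (n + k) = 0.
    elim: k => [|k IH]; first by rewrite addn0.
    have := r_ge0 (n + k.+1)%N; rewrite addnS /= IH mulr0.
    by have [->|->] := eR (n + k); lra.
  have [m nm em] := e_unbounded n.
  have := rk (m - n).+1; rewrite addnS subnKC//= -[in beta_remainder b m](subnKC nm) rk.
  by move: em; rewrite -(ltr0n R); lra.
have b_gt1 : 1 < b by have := r_gt0 1%N; rewrite /= e0; lra.
have r_bounded n : (b - 1) * beta_remainder b n <= 1.
  rewrite leNgt; apply/negP => rn.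
  have cg : continuous (fun c : R => (c - 1) * beta_remainder c n).
    move=> c; apply: cvgM; last exact: beta_remainder_continuous.
    by apply: cvgB => //; apply: cvg_cst.
  have [dl dl0 H] := near_b _ _ cg (@open_gt _ 1) rn.
  (* This [c] lies within [dl] of [b] and strictly between 1 and [b]; it turns out to belong to [B],
     against the choice of [b]. *)
  pose c := Num.max (b - dl / 2) ((1 + b) / 2).
  have cb : c < b by rewrite /c gt_max; apply/andP; split; lra.
  have c1 : 1 < c by rewrite /c lt_max; apply/orP; right; lra.
  have /H /= rc : `|b - c| < dl.
    rewrite gtr0_norm ?subr_gt0// ltrBlDr -ltrBlDl /c lt_max.
    by apply/orP; left; lra.
  suff : b <= c by rewrite leNgt cb.
  apply: ge_inf; first by exists 1.
  split; first by apply/andP; split; lra.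
  have r_pos k : 1 < (c - 1) * beta_remainder c k -> 0 <= beta_remainder c k.
    move=> h; rewrite -(pmulr_rge0 _ (_ : 0 < c - 1)); lra.
  move=> m; case: (leqP n m) => [nm|mn].
    by apply: r_pos; rewrite -(subnKC nm); exact: beta_remainder_escape.
  (* A negative remainder before place [n] would stay negative up to [n]. *)
  rewrite leNgt; apply/negP => rm.
  have := r_pos _ rc; rewrite leNgt -(subnKC (ltnW mn)).
  by rewrite beta_remainder_lt0S//; lra.
have r_wval n m : beta_remainder b n =
    wval b (mkseq (fun k => e (n + k)%N) m) + beta_remainder b (n + m) / b ^+ m.
  elim: m n => [|m IH] n; first by rewrite /= add0r expr0 divr1 addn0.
  have -> : mkseq (fun k => e (n + k)%N) m.+1 = e n :: mkseq (fun k => e (n.+1 + k)%N) m.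
    rewrite /mkseq /= (iotaDl 1 0 m) -map_comp addn0; congr (_ :: _).
    by apply: eq_map => k /=; rewrite addnS addSn.
  have := IH n.+1; rewrite addSnnS /= => rS.
  have bn0 : b != 0 by rewrite gt_eqF.
  have bm0 : b ^+ m != 0 by rewrite expf_neq0.
  rewrite exprS; set w := wval _ _ in rS *; set q := beta_remainder b (n + m).+1 in rS *.
  apply: (mulfI bn0); rewrite -[LHS](subrK (e n)%:R) rS; field; by rewrite bn0 bm0.
(* By the order condition truncated expansions have value below 1. So the excess of
   [beta_remainder b n] over 1, multiplied by [b ^+ m], is a lower bound for the remainder at
   [n + m], against [r_bounded]. *)
have r_le1 n : beta_remainder b n <= 1.
  rewrite leNgt; apply/negP => rn.
  have pow m : 1 + m%:R * (b - 1) <= b ^+ m.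
    elim: m => [|m IH]; first by rewrite mul0r addr0 expr0.
    have : 0 <= m%:R * (b - 1) * (b - 1) by rewrite !mulr_ge0//; lra.
    have : b * (1 + m%:R * (b - 1)) <= b * b ^+ m by rewrite ler_pM2l.
    by rewrite exprS -natr1; lra.
  have lb m : (beta_remainder b n - 1) * b ^+ m <= beta_remainder b (n + m).
    have bm : 0 < b ^+ m by rewrite exprn_gt0.
    have tails k : lelex (fun j => e (n + (k + j))%N) e.
      by have := @e_lelex (n + k)%N; under eq_fun do rewrite -addnA.
    have w1 : wval b (mkseq (fun k => e (n + k)%N) m) < 1.
      have adm := @lelex_admissible (fun k => e (n + k)%N) e m tails.
      apply: (@wval_lt _ b e (beta_remainder b) _ 0) => //.
        by case: (mkseq _ _) adm => //= ? ? [].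
      by case: (mkseq _ _) adm => //= ? ? [].
    rewrite -ler_pdivlMr// (r_wval n m); lra.
  have c0 : 0 < (b - 1) * ((beta_remainder b n - 1) * (b - 1)).
    by rewrite !mulr_gt0//; lra.
  set c := (b - 1) * _ in c0.
  have := @archi_boundP R c^-1; rewrite invr_ge0 => /(_ (ltW c0)).
  set m := Num.bound _ => hm.
  have cm : 1 < m%:R * c by rewrite -ltr_pdivrMr// div1r.
  have := r_bounded (n + m)%N; apply/negP; rewrite -ltNge.
  apply: (lt_le_trans cm).
  apply: le_trans (_ : (b - 1) * ((beta_remainder b n - 1) * b ^+ m) <= _); last first.
    by rewrite ler_pM2l//; lra.
  have : (beta_remainder b n - 1) * (m%:R * (b - 1)) <= (beta_remainder b n - 1) * b ^+ m.
    by rewrite ler_pM2l//; have := pow m; lra.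
  rewrite -(ler_pM2l (_ : 0 < b - 1)); last by lra.
  by rewrite /c; lra.
(* For [b >= 2] every remainder is at least 1, and a digit 0 would at least double it. *)
have b_lt2 : b < 2.
  rewrite ltNge; apply/negP => b_ge2.
  have r_ge1 n : 1 <= beta_remainder b n.
    elim: n => [|n IH] //=.
    have : 2 * beta_remainder b n <= b * beta_remainder b n by rewrite ler_pM2r.
    by have [->|->] := eR n; lra.
  have [p ep] := e_has0.
  have := r_le1 p.+1; rewrite /= ep.
  have : 2 * beta_remainder b p <= b * beta_remainder b p by rewrite ler_pM2r.
  by have := r_ge1 p; lra.
exists b, (beta_remainder b); split; first by rewrite b_gt1.
by split => // n; rewrite r_gt0 r_le1.
Qed.

End Parry.

(** * The coding a |-> 1^a 0 *)

Lemma int_ind_succ (P : int -> Prop) : P 0 ->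
  (forall n, P n -> P (n + 1)) -> (forall n, P (n + 1) -> P n) -> forall n, P n.
Proof.
move=> P0 PS PP; elim/int_ind => // k IH.
  by rewrite (_ : k.+1%:Z = k%:Z + 1); [exact: PS|lia].
by apply: PP; rewrite (_ : - k.+1%:Z + 1 = - k%:Z); [|lia].
Qed.

Section Coding.
Implicit Types (x y z : int -> nat) (n m i j k : int).

Definition shift x n : int -> nat := fun i => x (i + n).

(* Position in the concatenation of the words [1^(x i) 0] at which the word of
   index [n] starts, the word of index [0] starting at [0]. *)
Definition start x n : int :=
  match n with
  | Posz p => \sum_(i < p) (x i%:Z).+1%:Z
  | Negz p => - \sum_(i < p.+1) (x (Negz i)).+1%:Z
  end.

Lemma start0 x : start x 0 = 0.
Proof. by rewrite /= big_ord0. Qed.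

Lemma startS x n : start x (n + 1) = start x n + (x n)%:Z + 1.
Proof.
rewrite -addrA (_ : (x n)%:Z + 1 = (x n).+1%:Z); last by lia.
case: n => p.
  by rewrite (_ : p%:Z + 1 = p.+1%:Z) /= ?big_ord_recr//=; lia.
rewrite [start x (Negz p)]/= big_ord_recr /=.
case: p => [|p]; first by rewrite big_ord0 add0r addNr start0.
rewrite (_ : Negz p.+1 + 1 = Negz p) /=; last by lia.
by rewrite big_ord_recr /=; lia.
Qed.

Lemma start_shift x n k : start (shift x n) k = start x (k + n) - start x n.
Proof.
have kS i : i + 1 + n = i + n + 1 by lia.
elim/int_ind_succ: k => [|k IH|k]; first by rewrite start0 add0r subrr.
  by rewrite kS !startS IH /shift; lia.
by rewrite kS !startS /shift; lia.
Qed.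

Lemma start_growth x n (p : nat) : start x n + p%:Z <= start x (n + p%:Z).
Proof.
elim: p => [|p IH]; first by rewrite !addr0.
by rewrite (_ : n + p.+1%:Z = n + p%:Z + 1) ?startS; lia.
Qed.

Lemma start_lt x n m : (start x n < start x m) = (n < m).
Proof.
have [[p ->]|[p ->]] : (exists p : nat, m = n + p%:Z) \/ (exists p : nat, n = m + p%:Z).
- by case: (leP n m) => h; [left; exists `|m - n|%N|right; exists `|n - m|%N]; lia.
- case: p => [|p]; first by rewrite addr0; lia.
  by have := start_growth x n p.+1; lia.
- by have := start_growth x m p; lia.
Qed.

Lemma start_le x n m : (start x n <= start x m) = (n <= m).
Proof. by rewrite !leNgt start_lt. Qed.

Lemma start_locate x j : exists n, start x n <= j < start x (n + 1).
Proof.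
elim/int_ind_succ: j => [|j [n h]|j [n h]].
- by exists 0; rewrite start0 startS start0; lia.
- case: (ltP (j + 1) (start x (n + 1))) => h'; first by exists n; lia.
  by exists (n + 1); rewrite (startS _ (n + 1)); lia.
- case: (leP (start x n) j) => h'; first by exists n; lia.
  by exists (n - 1); have := startS x (n - 1); rewrite subrK; lia.
Qed.

(** A 0 sits just before each block start, that is, at the end of each block; describing the zeros
    avoids locating the block that contains [j]. *)
Definition code x j : nat := if `[< exists k, start x k = j + 1 >] then 0 else 1.

Lemma code_block x n j : start x n <= j <= start x n + (x n)%:Z ->
  code x j = (j != start x n + (x n)%:Z) :> nat.
Proof.
move=> h; rewrite /code; case: eqP => [->|jn] /=.
  by rewrite asboolT//; exists (n + 1); rewrite startS.
rewrite asboolF// => -[k ek].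
have : start x n < start x k < start x (n + 1) by rewrite ek startS; lia.
by rewrite !start_lt; lia.
Qed.

Lemma code_le1 x j : (code x j <= 1)%N.
Proof. by rewrite /code; case: ifP. Qed.

Lemma code_shift x n j : code (shift x n) j = code x (j + start x n).
Proof.
rewrite /code; congr (if _ then _ else _); apply/asbool_equiv_eq; split => -[k ek].
  by exists (k + n); move: ek; rewrite start_shift; lia.
by exists (k - n); rewrite start_shift subrK; lia.
Qed.

Lemma code0_start x j : code x (j - 1) = 0%N -> exists k, start x k = j.
Proof. by rewrite /code; case: asboolP => // -[k ek] _; exists k; rewrite ek subrK. Qed.

(** Decoding to the right: of two blocks with a common start, the shorter one has its final 0 where
    the longer still has a 1. *)
Lemma code_digitr x z n : start x n = start z n ->
  (forall j, start x n <= j < start x (n + 1) -> code x j = code z j) -> x n = z n.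
Proof.
rewrite startS => e H; case: (ltngtP (x n) (z n)) => // h.
  by have := H (start x n + (x n)%:Z); rewrite !(@code_block _ n); lia.
by have := H (start z n + (z n)%:Z); rewrite !(@code_block _ n); lia.
Qed.

(** Decoding to the left: blocks with a common end are told apart by the 0 that precedes the shorter
    one; hence the window reaches one place further left. *)
Lemma code_digitl x z n : start x (n + 1) = start z (n + 1) ->
  (forall j, start x n - 1 <= j < start x (n + 1) -> code x j = code z j) -> x n = z n.
Proof.
rewrite !startS => e H; case: (ltngtP (x n) (z n)) => // h.
  have := H (start x n - 1); rewrite (@code_block z n); last by lia.
  have := startS x (n - 1); rewrite subrK => e'.
  by rewrite (@code_block x (n - 1)); lia.
have := H (start z n - 1); rewrite (@code_block x n); last by lia.
have := startS z (n - 1); rewrite subrK => e'.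
by rewrite (@code_block z (n - 1)); lia.
Qed.

(** Both sequences have a block starting at 0, and the block boundaries are matched outward from
    there on both sides. The finiteness of the window is what makes decoding continuous. *)
Lemma code_window x z (K : nat) :
  (forall j, start x (- K%:Z) - 1 <= j < start x K%:Z -> code x j = code z j) ->
  forall n, - K%:Z <= n < K%:Z -> x n = z n.
Proof.
move=> H.
have P (p : nat) : (p <= K)%N -> start x p = start z p.
  elim: p => [|p IH] pK; first by rewrite !start0.
  have sp := IH (ltnW pK).
  rewrite (_ : p.+1%:Z = p%:Z + 1) ?startS; last by lia.
  rewrite sp (code_digitr sp)// => j hj; apply: H.
  have a : start x (- K%:Z) <= start x p by rewrite start_le; lia.
  have b : start x (p%:Z + 1) <= start x K by rewrite start_le; lia.
  lia.
have N (p : nat) : (p <= K)%N -> start x (- p%:Z) = start z (- p%:Z).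
  elim: p => [|p IH] pK; first by rewrite !start0.
  have := IH (ltnW pK).
  have [q qE] : exists q : int, q = - p.+1%:Z by eexists.
  rewrite (_ : - p%:Z = q + 1) -?qE; last by lia.
  move=> sp; suff xp : x q = z q by move: sp; rewrite !startS xp; lia.
  apply: code_digitl => // j hj; apply: H.
  have a : start x (- K%:Z) <= start x q by rewrite start_le; lia.
  have b : start x (q + 1) <= start x K by rewrite start_le; lia.
  lia.
move=> n hn.
have a : start x (- K%:Z) <= start x n by rewrite start_le; lia.
have b : start x (n + 1) <= start x K by rewrite start_le; lia.
case: (leP 0 n) => n0.
  have [p np] : exists p : nat, n = p%:Z by exists `|n|%N; lia.
  by apply: code_digitr => [|j hj]; [rewrite np; apply: P; lia|apply: H; lia].
have [p np] : exists p : nat, n + 1 = - p%:Z by exists `|(n + 1)%R|%N; lia.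
by apply: code_digitl => [|j hj]; [rewrite np; apply: N; lia|apply: H; lia].
Qed.

Lemma code_inj x z : code x =1 code z -> x =1 z.
Proof.
move=> e n; apply: (@code_window _ _ `|n|.+1); last by lia.
by move=> j _; exact: e.
Qed.

(** [code z] has a 0 at place -1, so [code x] has one at [m - 1], and [m] begins a block of [x]. *)
Lemma code_shift_inj x z m : (forall j, code z j = code x (j + m)) ->
  exists2 k, start x k = m & z = shift x k.
Proof.
move=> e; have [k km] : exists k, start x k = m.
  apply: code0_start; rewrite addrC -e.
  by rewrite /code asboolT//; exists 0; rewrite start0.
exists k => //; apply/funext; apply: code_inj => j.
by rewrite code_shift km e.
Qed.

Lemma code_prefix x z (p : nat) : (forall q : nat, (q < p)%N -> x q = z q) ->
  start x p = start z p /\ forall j, 0 <= j < start x p -> code x j = code z j.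
Proof.
move=> H; have S (q : nat) : (q <= p)%N -> start x q = start z q.
  move=> qp; rewrite /start; apply: eq_bigr => i _.
  by rewrite H// (leq_trans (ltn_ord i)).
split=> [|j jp]; first exact: S.
have [n hn] := start_locate x j.
have np : 0 <= n < p.
  have := start_lt x n p; have := start_lt x 0 (n + 1); rewrite start0; lia.
have nE : n = `|n|%N%:Z by lia.
have xz : x n = z n by rewrite nE H//; lia.
have sxz : start x n = start z n by rewrite nE S//; lia.
have := startS x n => e.
by rewrite (@code_block x n) ?(@code_block z n) ?xz ?sxz//; lia.
Qed.

(** At the first different letter the two blocks begin at the same place, and the smaller letter
    shows its 0 where the larger one still has a 1. *)
Lemma lelex_code x z :
  lelex (rtail (code x) 0) (rtail (code z) 0) <-> lelex (rtail x 0) (rtail z 0).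
Proof.
have rE w : rtail w 0 = fun q : nat => w q by apply/funext => q; rewrite /rtail add0r.
rewrite !rE; split=> H p agree.
- rewrite leqNgt; apply/negP => lt.
  have [sp cp] := code_prefix agree.
  have s0 : 0 <= start x p by rewrite -(start0 x) start_le.
  have [q qE] : exists q : nat, q%:Z = start x p + (z p)%:Z.
    by exists `|(start x p + (z p)%:Z)%R|%N; lia.
  have : (code x q <= code z q)%N.
    apply: H => j jq; case: (ltP j%:Z (start x p)) => h; first by apply: cp; lia.
    by rewrite (@code_block x p) ?(@code_block z p); lia.
  by rewrite (@code_block x p) ?(@code_block z p); lia.
(* Only [code z p = 0] with [code x p = 1] is to be excluded. Then [p] ends a block [k] of [z] and
   all earlier letters agree; [x k < z k] would show as a difference before [p], and [x k = z k]
   gives [code x p = 0]. *)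
- have := code_le1 x p.
  case cz : (code z p) => [|c] cx; last by apply: leq_trans cx _.
  rewrite leqn0; apply/eqP; apply: contrapT => cx1.
  have [k hk] := start_locate z p.
  have k0 : 0 <= k by have := start_lt z 0 (k + 1); rewrite start0; lia.
  have pE : p%:Z = start z k + (z k)%:Z.
    by move: cz; rewrite (@code_block z k); have := startS z k; lia.
  have xz (q : nat) : q%:Z <= k -> start x q = start z q /\ forall i : nat, (i < q)%N -> x i = z i.
    elim: q => [|q IH] qk; first by rewrite !start0.
    have [|sq dq] := IH; first by lia.
    have xq : x q = z q.
      apply/esym/code_digitr => // j hj.
      have sqk := start_le z (q%:Z + 1) k; have sq0 := start_le z 0 q; rewrite start0 in sq0.
      by have := agree `|j|%N; rewrite gez0_abs => [->|]; lia.
    rewrite (_ : q.+1%:Z = q%:Z + 1); last by lia.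
    rewrite !startS sq xq; split => // i; rewrite ltnS leq_eqVlt => /orP[/eqP->//|]; exact: dq.
  have [m km] : exists m : nat, k = m%:Z by exists `|k|%N; lia.
  subst k; have [|sk dk] := xz m; first by lia.
  have Hk : (x m <= z m)%N by apply: H.
  have xkz : x m = z m.
    apply/eqP; rewrite eqn_leq Hk /= leqNgt; apply/negP => lt.
    have [q qE] : exists q : nat, q%:Z = start x m + (x m)%:Z.
      by exists `|(start x m + (x m)%:Z)%R|%N; have := start_le x 0 m; rewrite start0; lia.
    by have := agree q; rewrite (@code_block x m) ?(@code_block z m); lia.
  by apply: cx1; rewrite (@code_block x m); lia.
Qed.

End Coding.

(** * The lexicographic shift under the coding, and its decoding *)

Section CodedShift.
Implicit Types (x y z : int -> nat) (d : nat -> nat).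

Lemma rtail_shift x (n : int) : rtail (shift x n) 0 = rtail x n.
Proof. by apply/funext => k; rewrite /rtail /shift add0r addrC. Qed.

(** At block starts this is [lelex_code]. A tail starting inside a block of [x] has fewer than [z 0]
    ones before its first 0, since [x n <= z 0], hence lies strictly below [code z]. *)
Lemma lelex_code_all x z :
  (forall j, lelex (rtail (code x) j) (rtail (code z) 0)) <->
  (forall i, lelex (rtail x i) (rtail z 0)).
Proof.
have E i : lelex (rtail (code x) (start x i)) (rtail (code z) 0) <->
    lelex (rtail x i) (rtail z 0).
  rewrite -(rtail_shift x) -lelex_code (_ : code (shift x i) = shift (code x) (start x i)).
    by rewrite rtail_shift.
  by apply/funext => j; exact: code_shift.
split=> H i; first by rewrite -E.
have [n hn] := start_locate x i; have := startS x n => sS.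
have [ei|ni] := eqVneq i (start x n); first by rewrite ei E.
have xz : (x n <= z 0%R)%N by have := H n 0%N; rewrite /rtail !addr0; apply.
have code_z (k : int) : 0 <= k <= (z 0)%:Z -> code z k = (k != (z 0)%:Z) :> nat.
  by have := @code_block z 0 k; rewrite start0 add0r.
have [q qE] : exists q : nat, i + q%:Z = start x n + (x n)%:Z.
  by exists `|(start x n + (x n)%:Z - i)%R|%N; lia.
move=> k agree; rewrite /rtail add0r.
have xiq : code x (i + q%:Z) = 0%N by rewrite qE (@code_block x n) ?eqxx//; lia.
case: (ltnP q k) => qk.
  by have := agree q qk; rewrite /rtail add0r xiq code_z; lia.
rewrite code_z; last by lia.
by apply: leq_trans (code_le1 _ _) _; lia.
Qed.

(** Padding makes [code] applicable to a one-sided sequence. With the letter 0 and [0 < d 0], the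
    tails from negative places lie below [d], as [code_seq_lelex] requires. *)
Definition extend d : int -> nat := fun i => if i is Posz n then d n else 0%N.

Definition code_seq d : nat -> nat := rtail (code (extend d)) 0.

Lemma rtail_extend d : rtail (extend d) 0 = d.
Proof. by apply/funext => k; rewrite /rtail add0r. Qed.

Lemma lexshift_code d x : lexshift (code_seq d) (code x) <-> lexshift d x.
Proof.
have := lelex_code_all x (extend d); rewrite rtail_extend; exact.
Qed.

Lemma lexshift_shift d x (n : int) : lexshift d x -> lexshift d (shift x n).
Proof.
move=> xd i; rewrite (_ : rtail _ _ = rtail x (i + n)); first exact: xd.
by apply/funext => k; rewrite /rtail /shift addrAC.
Qed.

Lemma code_seq_le1 d n : (code_seq d n <= 1)%N.
Proof. exact: code_le1. Qed.

Lemma code_seq0 d : (0 < d 0)%N -> code_seq d 0 = 1%N.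
Proof.
move=> d0; rewrite /code_seq /rtail addr0 (@code_block _ 0) start0 /=; last by lia.
by rewrite add0r; lia.
Qed.

Lemma code_seq_has0 d : code_seq d (d 0%N) = 0%N.
Proof.
by rewrite /code_seq /rtail (@code_block _ 0) start0 /=; rewrite ?add0r ?eqxx//; lia.
Qed.

Lemma code_seq_unbounded d : (forall n, exists2 m, (n <= m)%N & (0 < d m)%N) ->
  forall n, exists2 m, (n <= m)%N & (0 < code_seq d m)%N.
Proof.
move=> dub n; have [m nm dm] := dub n.
have := start_growth (extend d) 0 m; rewrite start0 !add0r => mp.
have [p pE] : exists p : nat, p%:Z = start (extend d) m.
  by exists `|start (extend d) m|%N; lia.
exists p; first by lia.
by rewrite /code_seq /rtail add0r pE (@code_block _ m) /=; lia.
Qed.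

Lemma code_seq_lelex d : (0 < d 0)%N -> (forall n, lelex (fun k => d (n + k)%N) d) ->
  forall n, lelex (fun k => code_seq d (n + k)%N) (code_seq d).
Proof.
move=> d0 dd n; rewrite (_ : (fun k => _) = rtail (code (extend d)) n); last first.
  by apply/funext => k; rewrite /code_seq /rtail add0r PoszD.
have := lelex_code_all (extend d) (extend d); rewrite rtail_extend => -[_]; apply.
case=> i; first by rewrite (_ : rtail _ _ = (fun k => d (i + k)%N)).
case=> [_|k /(_ 0%N)]; first by rewrite /rtail addr0.
by rewrite /rtail addr0 /= => /(_ isT) e; rewrite -e in d0.
Qed.

(** The sequence is cut after each of its zeros; as zeros recur on both sides, every block is finite
    and the cutting never stops. *)
Lemma code_surj y (m : int) : (forall j, (y j <= 1)%N) ->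
  (forall j, exists k : nat, y (j + k%:Z) = 0%N) ->
  (forall j, exists k : nat, y (j - k%:Z) = 0%N) ->
  y (m - 1) = 0%N -> exists x, forall j, code x j = y (j + m).
Proof.
move=> y1 yr yl ym.
pose next (a b : int) := [/\ a < b, y (b - 1) = 0%N & forall i, a <= i < b - 1 -> y i = 1%N].
have y1' j : (y j != 0 -> y j = 1)%N by have := y1 j; lia.
have nextr (a : int) : exists b : int, next a b.
  have /ex_minnP[k /eqP yk kmin] : exists k : nat, y (a + k%:Z) == 0%N.
    by have [k yk] := yr a; exists k; rewrite yk.
  exists (a + k%:Z + 1); split; first by lia.
    by rewrite addrK.
  rewrite addrK => i hi; apply: y1'; apply/negP => yi.
  have [p pE] : exists p : nat, i = a + p%:Z by exists `|(i - a)%R|%N; lia.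
  by have := kmin p; rewrite -pE yi => /(_ isT); lia.
have nextl (b : int) : y (b - 1) = 0%N -> exists a : int, next a b /\ y (a - 1) = 0%N.
  move=> yb; have /ex_minnP[k /eqP yk kmin] : exists k : nat, y (b - 1 - 1 - k%:Z) == 0%N.
    by have [k yk] := yl (b - 1 - 1); exists k; rewrite yk.
  exists (b - 1 - k%:Z); split; last by rewrite -[RHS]yk; congr y; lia.
  split=> //; first by lia.
  move=> i hi; apply: y1'; apply/negP => yi.
  have [p pE] : exists p : nat, i = b - 1 - 1 - p%:Z by exists `|(b - 1 - 1 - i)%R|%N; lia.
  by have := kmin p; rewrite -pE yi => /(_ isT); lia.
have [nxt nxtP] := choice nextr.
(* A previous cut is wanted only when [b] is itself a cut; elsewhere the condition is vacuous and
   the value of [prv] arbitrary. *)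
have /choice[prv prvP] (b : int) : exists a : int, y (b - 1) = 0%N -> next a b /\ y (a - 1) = 0%N.
  case: (eqVneq (y (b - 1)) 0%N) => [/nextl[a ha]|yb]; first by exists a.
  by exists 0 => yb0; rewrite yb0 eqxx in yb.
pose p (n : int) : int := match n with Posz k => iter k nxt m | Negz k => iter k.+1 prv m end.
have p_start k : y (iter k prv m - 1) = 0%N.
  by elim: k => //= k /prvP[].
have pP n : next (p n) (p (n + 1)).
  case: n => k; first by rewrite (_ : k%:Z + 1 = k.+1%:Z) /=; [exact: nxtP|lia].
  rewrite (_ : p (Negz k + 1) = iter k prv m) /=; first by have [] := prvP _ (p_start k).
  by case: k => // k; rewrite (_ : Negz k.+1 + 1 = Negz k)//; lia.
pose x (n : int) := `|(p (n + 1) - p n - 1)%R|%N.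
have sx n : start x n = p n - m.
  have xE (k : int) : (x k)%:Z = p (k + 1) - p k - 1.
    by have [pk _ _] := pP k; rewrite /x; lia.
  elim/int_ind_succ: n => [|n|n]; first by rewrite start0 subrr.
    by rewrite startS xE => ->; transitivity (p (n + 1) - m); first lia.
  have [b bE] : exists b, b = p (n + 1) by eexists.
  move=> h; have {h} : start x (n + 1) = b - m by rewrite bE.
  by rewrite startS xE -bE; lia.
exists x => j; have [n hn] := start_locate x j.
have xE : (x n)%:Z = p (n + 1) - p n - 1 by rewrite /x; have [] := pP n; lia.
have [pn yn yi] := pP n; have sS := startS x n; have sn := sx n.
rewrite (@code_block x n); last by lia.
case: eqP => [->|jn] /=; first by rewrite -[LHS]yn; congr y; lia.
by rewrite yi//; lia.
Qed.
End CodedShift.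

(** * The time change *)

(* Monotonicity in the real variable upgrades separate to joint continuity. *)
Lemma inverse_jointly_continuous (R : realType) (T : topologicalType) (F G : T -> R -> R) :
  (forall x, {homo F x : s t / s < t}) -> (forall x u, F x (G x u) = u) ->
  (forall t, continuous (fun x => F x t)) ->
  continuous (fun p : T * R => G p.1 p.2).
Proof.
move=> Fmono FG Fc [x0 u0]; apply/cvgrPdist_lt => e e0 /=.
have Fl : F x0 (G x0 u0 - e) < u0 by rewrite -[ltRHS](FG x0); apply: Fmono; lra.
have Fr : u0 < F x0 (G x0 u0 + e) by rewrite -[ltLHS](FG x0); apply: Fmono; lra.
pose cl := (F x0 (G x0 u0 - e) + u0) / 2; pose cr := (F x0 (G x0 u0 + e) + u0) / 2.
have nl : \forall x \near x0, F x (G x0 u0 - e) < cl.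
  by apply: (Fc _ x0 _ (open_nbhs_nbhs (conj (@open_lt _ cl) _))); rewrite /cl /=; lra.
have nr : \forall x \near x0, cr < F x (G x0 u0 + e).
  by apply: (Fc _ x0 _ (open_nbhs_nbhs (conj (@open_gt _ cr) _))); rewrite /cr /=; lra.
have nu : \forall u \near u0, cl < u < cr.
  near=> u; apply/andP; split; near: u.
    by apply: open_nbhs_nbhs; split; [exact: open_gt|rewrite /cl /=; lra].
  by apply: open_nbhs_nbhs; split; [exact: open_lt|rewrite /cr /=; lra].
near=> p.
have pl : F p.1 (G x0 u0 - e) < cl by near: p; apply: (cvg_fst nl).
have pr : cr < F p.1 (G x0 u0 + e) by near: p; apply: (cvg_fst nr).
have pu : cl < p.2 < cr by near: p; apply: (cvg_snd nu).
have Fle s t : s <= t -> F p.1 s <= F p.1 t.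
  by rewrite le_eqVlt => /orP[/eqP->//|/(Fmono p.1)/ltW].
have gl : G x0 u0 - e < G p.1 p.2.
  by rewrite ltNge; apply/negP => /Fle; rewrite FG; lra.
have gr : G p.1 p.2 < G x0 u0 + e.
  by rewrite ltNge; apply/negP => /Fle; rewrite FG; lra.
by rewrite ltr_norml; lra.
Unshelve. all: by end_near.
Qed.

Section Height.
Context {R : realType}.
Implicit Types (x z : int -> nat) (t u : R) (n : int).

(** The piecewise linear interpolation of [start x] at the integers, with slope [x n + 1] over the
    unit interval of the letter [x n]. *)
Definition height x t : R :=
  (start x (Num.floor t))%:~R + (t - (Num.floor t)%:~R) * (x (Num.floor t)).+1%:R.

Lemma height_floor x t n : n%:~R <= t < n%:~R + 1 ->
  height x t = (start x n)%:~R + (t - n%:~R) * (x n).+1%:R.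
Proof. by move=> h; rewrite /height (@floor_def _ t n)// intrD. Qed.

Lemma floor_bounds t : (Num.floor t)%:~R <= t < (Num.floor t)%:~R + 1.
Proof. by rewrite -[1]/(1%:~R) -intrD floor_itv. Qed.

(** This cocycle identity makes [(x, t) |-> (code x, height x t)] respect the identification in the
    suspension. *)
Lemma height_shift x n t :
  height (shift x n) (t - n%:~R) = height x t - (start x n)%:~R.
Proof.
have h := floor_bounds t; set m := Num.floor t in h *.
rewrite (height_floor _ h) (@height_floor _ _ (m - n)); last by rewrite intrB; lra.
by rewrite start_shift /shift subrK !intrB; ring.
Qed.

Lemma startS_R x n : (start x (n + 1))%:~R = (start x n)%:~R + (x n).+1%:R :> R.
Proof. by rewrite startS -addrA intrD -natr1 intrD -pmulrn. Qed.

Lemma height_mono x : {homo height x : t u / t < u}.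
Proof.
move=> t u tu; have ht := floor_bounds t; have hu := floor_bounds u.
have : Num.floor t <= Num.floor u by apply: le_floor; exact: ltW.
rewrite le_eqVlt => /orP[/eqP e|lt]; rewrite /height.
  by rewrite -e ltrD2l ltr_pM2r ?ltr0n//; lra.
have : (start x (Num.floor t + 1))%:~R <= (start x (Num.floor u))%:~R :> R.
  by rewrite ler_int start_le; lia.
rewrite startS_R; set a := (x (Num.floor t)).+1%:R; set b := (x (Num.floor u)).+1%:R.
have a0 : 0 < a by rewrite ltr0n.
have b0 : 0 < b by rewrite ltr0n.
have : (t - (Num.floor t)%:~R) * a < 1 * a by rewrite ltr_pM2r//; lra.
have : 0 <= (u - (Num.floor u)%:~R) * b by rewrite mulr_ge0//; lra.
lra.
Qed.

Lemma height_surj x u : exists t, height x t = u.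
Proof.
have hu := floor_bounds u; have [n /andP[n1 n2]] := start_locate x (Num.floor u).
have {}n1 : (start x n)%:~R <= (Num.floor u)%:~R :> R by rewrite ler_int.
have {}n2 : (Num.floor u)%:~R + 1 <= (start x (n + 1))%:~R :> R.
  by rewrite -[1]/(1%:~R) -intrD ler_int; lia.
rewrite startS_R in n2; have a0 : 0 < (x n).+1%:R :> R by rewrite ltr0n.
exists (n%:~R + (u - (start x n)%:~R) / (x n).+1%:R).
rewrite (@height_floor _ _ n).
  by rewrite [n%:~R + _ - _]addrAC subrr add0r divfK ?gt_eqF//; ring.
have : 0 <= (u - (start x n)%:~R) / (x n).+1%:R by rewrite divr_ge0//; lra.
have : (u - (start x n)%:~R) / (x n).+1%:R < 1 by rewrite ltr_pdivrMr//; lra.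
by set q := _ / _ => q1 q0; lra.
Qed.

Definition inv_height x u : R := projT1 (cid (height_surj x u)).

Lemma inv_heightK x u : height x (inv_height x u) = u.
Proof. exact: projT2 (cid (height_surj x u)). Qed.

Lemma height_inj x : injective (height x).
Proof.
move=> t u e; case: (ltgtP t u) => // /(@height_mono x); by rewrite e ltxx.
Qed.

Lemma heightK x t : inv_height x (height x t) = t.
Proof. by apply: (@height_inj x); rewrite inv_heightK. Qed.

Lemma inv_height_mono x : {homo inv_height x : t u / t < u}.
Proof.
move=> t u tu; rewrite ltNge; apply/negP; rewrite le_eqVlt => /orP[/eqP e|].
  by move: tu; rewrite -(inv_heightK x t) -e inv_heightK ltxx.
by move/(@height_mono x); rewrite !inv_heightK; lra.
Qed.

Lemma inv_height_shift x n u :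
  inv_height (shift x n) (u - (start x n)%:~R) = inv_height x u - n%:~R.
Proof.
by apply: (@height_inj (shift x n)); rewrite height_shift !inv_heightK.
Qed.

Lemma near_window (x0 : fullshift) (K : nat) :
  \forall x \near x0, forall i : int, - K%:Z <= i < K%:Z -> x i = x0 i.
Proof.
have coord (i : int) : \forall x \near x0, x i = x0 i.
  exact: (@proj_continuous int (fun=> nat) i x0 _ (discrete_set1 (x0 i))).
elim: K => [|K IH]; first by near=> x => i; lia.
near=> x => i hi.
have [->|ni] := eqVneq i K%:Z; first by near: x; exact: coord.
have [->|ni'] := eqVneq i (- K.+1%:Z); first by near: x; exact: coord.
have : - K%:Z <= i < K%:Z by lia.
move: i {hi ni ni'}; near: x; exact: IH.
Unshelve. all: by end_near.
Qed.

Lemma start_window x z (K : nat) : (forall i, - K%:Z <= i < K%:Z -> x i = z i) ->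
  forall n, - K%:Z <= n <= K%:Z -> start x n = start z n.
Proof.
move=> xz; case=> k hk /=.
  by apply: eq_bigr => i _; rewrite xz//; have := ltn_ord i; lia.
by congr (- _); apply: eq_bigr => i _; rewrite xz//; have := ltn_ord i; lia.
Qed.

(** For fixed [t] only finitely many coordinates of [x] enter, so the function is locally constant
    in [x]. *)
Lemma height_continuous_l t : continuous (fun x : fullshift => height x t).
Proof.
move=> x0; pose K := (`|Num.floor t|%N).+1.
apply: cvg_near_cst.
near=> x; have win : forall i : int, - K%:Z <= i < K%:Z -> x i = x0 i.
  by near: x; exact: near_window.
rewrite /height (start_window win) ?win//; rewrite /K; lia.
Unshelve. all: by end_near.
Qed.

Lemma inv_height_continuous :
  continuous (fun p : fullshift * R => inv_height p.1 p.2).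
Proof.
by apply: (@inverse_jointly_continuous R fullshift height inv_height);
  [exact: height_mono|exact: inv_heightK|exact: height_continuous_l].
Qed.

(** The roles are exchanged: joint continuity of [inv_height] gives the separate continuity needed
    to apply the same lemma to its inverse. *)
Lemma height_continuous : continuous (fun p : fullshift * R => height p.1 p.2).
Proof.
apply: (@inverse_jointly_continuous R fullshift inv_height height);
  [exact: inv_height_mono|exact: heightK|move=> u x0].
have pr : (fun x : fullshift => (x, u)) @ x0 --> (x0, u).
  apply: (@cvg_pair _ _ _ (nbhs x0) (nbhs x0) (nbhs u) _ _ _ id (fun=> u)).
      exact: cvg_id.
    exact: cvg_cst.
exact: (@cvg_comp _ _ _ (fun x => (x, u)) (fun p => inv_height p.1 p.2) _ _ _ pr
  (@inv_height_continuous (x0, u))).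
Qed.

Lemma code_continuous (x0 : fullshift) (j : int) : \forall x \near x0, code x j = code x0 j.
Proof.
have [n hn] := start_locate x0 j; have sS := startS x0 n.
near=> x; have win : forall i : int, - `|n|.+1%:Z <= i < `|n|.+1%:Z -> x i = x0 i.
  by near: x; exact: near_window.
have sn : start x n = start x0 n by apply: (start_window win); lia.
have xn : x n = x0 n by apply: win; lia.
by rewrite (@code_block x n) ?(@code_block x0 n) ?sn ?xn//; lia.
Unshelve. all: by end_near.
Qed.

End Height.

(** * Suspensions *)

Section SuspensionPi.
Context {R : realType} {A : topologicalType} (X : set {ptws int -> A}).
Local Open Scope quotient_scope.

Lemma susp_eqP (p q : set_type X * R) :
  \pi_(suspension R X) p = \pi_(suspension R X) q <-> susp_rel p q.
Proof.
split=> [/eqmodP/asboolP //|h]; by apply/eqmodP/asboolP.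
Qed.

Lemma susp_flow_pi (p : set_type X * R) (r : R) :
  susp_flow (\pi_(suspension R X) p) r = \pi_(suspension R X) (p.1, p.2 + r).
Proof.
rewrite /susp_flow; apply/susp_eqP.
have [n [h1 h2]] : susp_rel (repr (\pi_(suspension R X) p)) p by apply/susp_eqP; rewrite reprK.
by exists n; split => //=; rewrite h2 addrAC.
Qed.

Lemma susp_lift (Z : topologicalType) (f : set_type X * R -> Z) :
  continuous f -> (forall p q, susp_rel p q -> f p = f q) ->
  exists2 g : suspension R X -> Z, continuous g & forall p, g (\pi_(suspension R X) p) = f p.
Proof.
move=> fc fE; exists (f \o repr) => [|p /=]; last first.
  by apply: fE; apply/susp_eqP; rewrite reprK.
apply: repr_comp_continuous => // p q /eqP /susp_eqP pq.
by apply/eqP; exact: fE.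
Qed.

End SuspensionPi.

Lemma pair_continuous (T U V : topologicalType) (f : T -> U) (g : T -> V) (x : T) :
  {for x, continuous f} -> {for x, continuous g} ->
  {for x, continuous (fun t => (f t, g t))}.
Proof. by move=> fx gx; apply: (@cvg_pair _ _ _ (nbhs x) (nbhs (f x)) (nbhs (g x))). Qed.

Lemma cvg_set_type (T : Type) (F : set_system T) (X : set fullshift)
  (f : T -> set_type X) (x0 : set_type X) : Filter F ->
  (forall i, \forall t \near F, set_val (f t) i = set_val x0 i) -> f @ F --> x0.
Proof.
move=> FF near_eq.
have c : (fun t => set_val (f t)) @ F --> (set_val x0 : fullshift).
  apply/cvg_sup => i U [V] [[W] oW <-] Wx WU.
  apply: (filterS WU); change (F [set t | W (set_val (f t) i)]).
  by apply: filterS (near_eq i) => t /= ->.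
move=> U [V [[W oW <-] Wx] WU]; apply: (filterS WU).
by apply: c; exact: open_nbhs_nbhs.
Qed.

(** * The homeomorphism between the two suspensions *)

Section Coded.
Context {R : realType}.
Variable d : nat -> nat.
Hypothesis d_gt0 : (0 < d 0)%N.
Local Open Scope quotient_scope.

Let X := lexshift d.
Let Y := lexshift (code_seq d).

Lemma coded_le1 y : Y y -> forall j, (y j <= 1)%N.
Proof.
move=> Yy j; have := Yy j 0%N; rewrite /rtail addr0 code_seq0//; exact.
Qed.

(** [code_seq d] begins with [1^(d 0) 0], so no tail of [y] may begin with [d 0 + 1] ones. The
    uniform bound on the gaps also yields zeros to the left. *)
Lemma coded_has0 y : Y y -> forall j : int, exists2 k : nat, (k <= d 0)%N & y (j + k%:Z) = 0%N.
Proof.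
move=> Yy j; apply: contrapT => H.
have y1 (k : nat) : (k <= d 0)%N -> y (j + k%:Z) = 1%N.
  move=> kd; have := coded_le1 Yy (j + k%:Z); case E : (y _) => [|[]]// _.
  by exfalso; apply: H; exists k.
have : (rtail y j (d 0%N) <= code_seq d (d 0%N))%N.
  apply: Yy => k kd.
  rewrite /rtail y1 1?ltnW// /code_seq /rtail add0r (@code_block _ 0) start0 /=; last by lia.
  by rewrite add0r; lia.
by rewrite code_seq_has0 /rtail y1.
Qed.

Lemma coded_surj y m : Y y -> y (m - 1) = 0%N -> exists2 x, X x & code x = shift y m.
Proof.
move=> Yy ym.
have [||x xy] := code_surj (coded_le1 Yy) _ _ ym.
- by move=> j; have [k _ yk] := coded_has0 Yy j; exists k.
- move=> j; have [k kd yk] := coded_has0 Yy (j - (d 0%N)%:Z).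
  by exists (d 0 - k)%N; rewrite -[RHS]yk; congr y; lia.
have {}xy : code x = shift y m by apply/funext.
by exists x => //; apply/lexshift_code; rewrite xy; exact: lexshift_shift.
Qed.

Lemma coded_surj_ex y : Y y -> exists m, y (m - 1) = 0%N.
Proof.
by move=> Yy; have [k _ yk] := coded_has0 Yy 0; exists (k%:Z + 1); rewrite addrK -[RHS]yk add0r.
Qed.

Lemma code_mem (x : set_type X) : (code (set_val x) : fullshift) \in Y.
Proof. by apply/mem_set/lexshift_code; exact: set_valP. Qed.

Definition code_point (x : set_type X) : set_type Y := SigSub (code_mem x).

Lemma code_point_continuous : continuous code_point.
Proof.
move=> x; apply: (@cvg_set_type _ (nbhs x)) => j.
exact: (@initial_continuous _ _ set_val x _ (code_continuous (set_val x) j)).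
Qed.

Lemma decode_exists (m : int) (y : set_type Y) : exists x : set_type X,
  set_val y (m - 1) = 0%N -> code (set_val x) = shift (set_val y) m.
Proof.
have Yy : Y (set_val y) by exact: set_valP.
(* [decode m] has to be total: where [m] is not a cut of [y], another cut is used. *)
have [m' ym'] : exists m', set_val y (m' - 1) = 0%N /\
    (set_val y (m - 1) = 0%N -> m' = m).
  have [ym|ym] := eqVneq (set_val y (m - 1)) 0%N; first by exists m.
  by have [m' ym'] := coded_surj_ex Yy; exists m'; split => // /eqP; rewrite (negbTE ym).
case: ym' => /(coded_surj Yy)[x Xx xy] mm'.
by exists (SigSub (mem_set Xx)) => /mm' <-.
Qed.

Definition decode m y := projT1 (cid (decode_exists m y)).

Lemma decodeP m y : set_val y (m - 1) = 0%N ->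
  code (set_val (decode m y)) = shift (set_val y) m.
Proof. exact: projT2 (cid (decode_exists m y)). Qed.

(** A cut chosen without any continuity in [y]; [decode_rel] makes the choice immaterial. *)
Definition base (y : set_type Y) : int := projT1 (cid (coded_surj_ex (set_valP y))).

Lemma baseP y : set_val y (base y - 1) = 0%N.
Proof. exact: projT2 (cid (coded_surj_ex (set_valP y))). Qed.

(** Both points decode translates of one sequence, hence differ by a shift of [k] letters, and the
    cocycle identity for [inv_height] matches the times. *)
Lemma decode_rel (x x' : set_type X) (y : int -> nat) (m m' n : int) (s : R) :
  code (set_val x) = shift y m -> code (set_val x') = shift (shift y n) m' ->
  susp_rel (x, inv_height (set_val x) (s - m%:~R))
    (x', inv_height (set_val x') (s - n%:~R - m'%:~R)).
Proof.
move=> xy xy'.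
have [|k km xk] := @code_shift_inj (set_val x) (set_val x') (m' + n - m).
  by move=> j; rewrite xy xy' /shift; congr y; lia.
exists k; split => [i|/=]; first by rewrite /= xk.
rewrite xk -inv_height_shift km; congr inv_height.
by rewrite intrB intrD; ring.
Qed.

Lemma decode_continuous (m : int) (y : set_type Y) :
  set_val y (m - 1) = 0%N -> {for y, continuous (decode m)}.
Proof.
move=> ym; apply: (@cvg_set_type _ (nbhs y)) => i.
pose x := set_val (decode m y); pose K := `|i|%N.+1.
(* [L] covers the window that [code_window] needs for [K], its extra place on the left included,
   after translation by [m]. *)
pose L := (`|start x (- K%:Z)| + `|start x K| + `|m| + 2)%N.
have : \forall z \near y, forall j : int, - L%:Z <= j < L%:Z -> set_val z j = set_val y j.
  exact: (@initial_continuous _ _ set_val y _ (near_window (set_val y) L)).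
apply: filterS => z zy.
have zm : set_val z (m - 1) = 0%N by rewrite zy//; rewrite /L; lia.
apply/esym; apply: (@code_window _ _ K) => [j|]; last by rewrite /K; lia.
rewrite -/x => hj; rewrite !decodeP// /shift zy// /L; lia.
Qed.

Definition decode_flow (m : int) (p : set_type Y * R) : set_type X * R :=
  (decode m p.1, inv_height (set_val (decode m p.1)) (p.2 - m%:~R)).

Lemma decode_flow_continuous (m : int) (p : set_type Y * R) :
  set_val p.1 (m - 1) = 0%N -> {for p, continuous (decode_flow m)}.
Proof.
move=> pm; have dc : {for p, continuous (fun q : set_type Y * R => decode m q.1)}.
  apply: (@continuous_comp _ _ _ fst (decode m)); first exact: cvg_fst.
  exact: decode_continuous.
apply: pair_continuous => //.
apply: (@continuous_comp _ _ _
  (fun q : set_type Y * R => (set_val (decode m q.1) : fullshift, q.2 - m%:~R))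
  (fun q : fullshift * R => inv_height q.1 q.2)); last exact: inv_height_continuous.
apply: pair_continuous.
  apply: (@continuous_comp _ _ _ (fun q : set_type Y * R => decode m q.1)) => //.
  exact: initial_continuous.
by apply: cvgB; [exact: cvg_snd|exact: cvg_cst].
Qed.

Lemma coded_homeo : exists Phi : suspension R X -> suspension R Y, homeomorphism Phi /\
  forall x t, Phi (\pi_(suspension R X) (x, t)) =
    \pi_(suspension R Y) (code_point x, height (set_val x) t).
Proof.
pose F (p : set_type X * R) := \pi_(suspension R Y) (code_point p.1, height (set_val p.1) p.2).
have Fc : continuous F.
  move=> p; apply: (@continuous_comp _ _ _
    (fun q : set_type X * R => (code_point q.1, height (set_val q.1) q.2)));
    last exact: pi_continuous.
  apply: pair_continuous.
    apply: (@continuous_comp _ _ _ fst code_point); first exact: cvg_fst.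
    exact: code_point_continuous.
  apply: (@continuous_comp _ _ _ (fun q : set_type X * R => (set_val q.1 : fullshift, q.2))
    (fun q : fullshift * R => height q.1 q.2)); last exact: height_continuous.
  apply: pair_continuous; last exact: cvg_snd.
  apply: (@continuous_comp _ _ _ fst (fun x : set_type X => set_val x)); first exact: cvg_fst.
  exact: initial_continuous.
have FE p q : susp_rel p q -> F p = F q.
  move=> [n [h1 h2]]; apply/susp_eqP; exists (start (set_val p.1) n).
  have e : set_val q.1 = shift (set_val p.1) n by apply/funext.
  split => [i|/=]; last by rewrite e h2 height_shift.
  change (code (set_val q.1) i = code (set_val p.1) (i + start (set_val p.1) n)).
  by rewrite e code_shift.
pose G (p : set_type Y * R) := \pi_(suspension R X) (decode_flow (base p.1) p).
have GE p q : susp_rel p q -> G p = G q.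
  move=> [n [h1 h2]]; apply/susp_eqP; rewrite /decode_flow h2.
  apply: (@decode_rel _ _ (set_val p.1)); first exact: decodeP (baseP _).
  by rewrite decodeP ?baseP//; congr shift; apply/funext.
(* Any cut may replace [base]. As having a cut at [m] is an open condition, [G] coincides near each
   point with a continuous map built from a fixed [m]. *)
have G_any p m : set_val p.1 (m - 1) = 0%N -> G p = \pi_(suspension R X) (decode_flow m p).
  move=> pm; apply/susp_eqP; rewrite /decode_flow -[in X in susp_rel _ (_, X)](subr0 p.2).
  apply: (@decode_rel _ _ (set_val p.1) _ _ 0); first exact: decodeP (baseP _).
  by rewrite decodeP//; congr shift; apply/funext => i; rewrite /shift addr0.
have Gc : continuous G.
  move=> p; have pb := baseP p.1; set m := base p.1 in pb.
  have dc := decode_flow_continuous pb.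
  have c : {for p, continuous (fun q => \pi_(suspension R X) (decode_flow m q))}.
    by apply: continuous_comp => //; exact: pi_continuous.
  rewrite /continuous_at (G_any _ _ pb); apply: cvg_trans c; apply: near_eq_cvg.
  have nb : \forall y \near p.1, set_val y (m - 1) = 0%N.
    rewrite -pb; have coord :
      \forall x \near (set_val p.1 : fullshift), x (m - 1) = set_val p.1 (m - 1).
      exact: (@proj_continuous int (fun=> nat) (m - 1) _ _ (discrete_set1 _)).
    exact: (@initial_continuous _ _ set_val p.1 _ coord).
  have : \forall q \near p, set_val q.1 (m - 1) = 0%N by exact: (cvg_fst nb).
  by apply: filterS => q qm; rewrite (G_any _ _ qm).
have [Phi Phic PhiE] := susp_lift Fc FE; have [Psi Psic PsiE] := susp_lift Gc GE.
exists Phi; split; last by move=> x t; rewrite PhiE.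
split=> //; exists Psi; split => // z.
- rewrite -[z]reprK PhiE PsiE; case: (repr z) => x t.
  (* Place 0 is a cut of every code, and decoding there returns [x] itself. *)
  have b0 : set_val (code_point x) (0 - 1) = 0%N.
    change (code (set_val x) (0 - 1) = 0%N).
    by rewrite /code asboolT//; exists 0; rewrite start0.
  rewrite (G_any _ 0)//; apply/susp_eqP; rewrite /decode_flow /= subr0.
  have -> : decode 0 (code_point x) = x.
    apply: val_inj; apply/funext; apply: code_inj => j.
    by rewrite decodeP// /shift addr0.
  by rewrite heightK; exists 0; split => [i|]; rewrite ?addr0 ?subr0.
- rewrite -[z]reprK PsiE PhiE; case: (repr z) => y s.
  apply/susp_eqP; rewrite /decode_flow /= inv_heightK.
  (* Decoding at [base y] and coding again translates [y] and its time by [base y], which is the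
     same point of the suspension. *)
  exists (- base y); split=> [i|/=]; last by rewrite intrN opprK subrK.
  change (set_val y i = code (set_val (decode (base y) y)) (i + - base y)).
  by rewrite decodeP ?baseP// /shift addrNK.
Qed.

End Coded.

Theorem theorem4p5 (R : realType) (beta : R) :
  1 < beta ->
  exists beta' : R, 1 < beta' < 2 /\
    flow_equivalent R (beta_shift beta) (beta_shift beta').
Proof.
move=> b1; have [d [r dr]] := quasi_greedy_exists b1.
have d0 := quasi_greedy_gt0 b1 dr.
have [b' [r' [b'12 dr']]] := @parry R (code_seq d) (@code_seq_le1 d)
  (code_seq_unbounded (fun n => quasi_greedy_unbounded n b1 dr))
  (code_seq0 d0) (ex_intro _ _ (code_seq_has0 d))
  (code_seq_lelex d0 (fun n => @quasi_greedy_lelex _ _ _ _ n (lt_trans ltr01 b1) dr)).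
exists b'; split => //.
rewrite (beta_shift_lexshift (lt_trans ltr01 b1) dr).
rewrite (beta_shift_lexshift _ dr'); last by lra.
have [Phi [hom PhiE]] := @coded_homeo R d d0.
exists Phi; split => // z; case E : (repr z) => [x t].
have zE : z = \pi_(suspension R (lexshift d))%qT (x, t) by rewrite -E reprK.
(* Time [s] along the orbit of [[x, t]] becomes the increment of [height] from [t] to [t + s]. *)
exists (fun s => height (set_val x) (t + s) - height (set_val x) t); split=> [s u su|s].
  by rewrite ltrD2r; apply: height_mono; rewrite ltrD2l.
by rewrite zE susp_flow_pi !PhiE susp_flow_pi /= [height _ t + _]addrC subrK.
Qed.
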